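(* Let $(X,\operatorname{dist})$ be a compact metric space with infinitely many points and let $f\colon X\to X$ be a positively expansive continuous map. Then the polynomial entropy of $f$ satisfies $h_{pol}(f)\geq 1$.
   Context: A continuous map $f\colon X\to X$ of a compact metric space $(X,\operatorname{dist})$ is positively expansive if there is $\delta>0$ such that whenever $x,y\in X$ satisfy $\operatorname{dist}(f^n(x),f^n(y))<\delta$ for all $n\geq 0$, then $x=y$. Polynomial entropy: for $n\geq 1$ and $\varepsilon>0$, a set $E\subset X$ is $(n,\varepsilon)$-spanning for $f$ if for each $y\in X$ there is $x\in E$ with $\operatorname{dist}(f^k(x),f^k(y))\leq\varepsilon$ for all $0\leq k\leq n-1$. Let $r_n(\varepsilon)$ be the minimum cardinality of an $(n,\varepsilon)$-spanning set. Define $h_{pol}^{\varepsilon}(f)=\limsup_{n\to\infty}\frac{\log r_n(\varepsilon)}{\log n}$ and $h_{pol}(f)=\lim_{\varepsilon\to 0}h_{pol}^{\varepsilon}(f)\in[0,\infty]$ (the limit exists by monotonicity in $\varepsilon$). *)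

(* Defs.v *)
From HB Require Import structures.
From mathcomp Require Import all_boot all_order all_algebra finmap.
From mathcomp Require Import all_classical all_reals all_analysis.

Set Implicit Arguments.
Unset Strict Implicit.
Unset Printing Implicit Defensive.

Import Order.TTheory GRing.Theory Num.Theory.
Import numFieldNormedType.Exports.

Local Open Scope classical_set_scope.
Local Open Scope card_scope.
Local Open Scope ring_scope.

Section polynomial_entropy.
Context {R : realType} {X : metricType R}.
Implicit Types (f : X -> X) (n k m : nat) (eps : R) (E : set X).

Definition positively_expansive f : Prop :=
  exists2 delta : R, 0 < delta &
    forall x y : X,
      (forall n, mdist (iter n f x) (iter n f y) < delta) -> x = y.

Definition spanning f n eps E : Prop :=
  forall y : X, exists2 x : X, E x &
    forall k, (k < n)%N -> mdist (iter k f x) (iter k f y) <= eps.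

Definition spanning_cards f n eps : set nat :=
  [set m | exists E, E #= `I_m /\ spanning f n eps E].

(* The default value 0 of xget is used only if there is no finite spanning
   set; spanning_numberP excludes this for X compact, f continuous, 0 < eps. *)
Definition spanning_number f n eps : nat :=
  xget 0%N [set m | spanning_cards f n eps m /\
                    forall j, spanning_cards f n eps j -> (m <= j)%N].

Definition hpol_eps f eps : \bar R :=
  limn_esup (fun n =>
    (ln (spanning_number f n eps)%:R / ln n%:R : R)%:E).

(* The limit exists when X is compact and f continuous: see is_cvg_hpol_eps. *)
Definition hpol f : \bar R := lim (hpol_eps f eps @[eps --> 0^'+]).

Lemma continuous_iter f k : continuous f -> continuous (iter k f).
Proof.
move=> cf; elim: k => [|k IH] x /=; first exact: cvg_id.
exact: (@continuous_comp _ _ _ (iter k f) f x (IH x) (cf _)).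
Qed.

Lemma spanning_cards_neq0 f n eps : compact [set: X] -> continuous f ->
  0 < eps -> spanning_cards f n eps !=set0.
Proof.
move=> cX cf e0.
have [[x0 _]|X0] := pselect (exists x : X, True); last first.
  exists 0%N, set0; split; first by rewrite II0.
  by move=> y; exfalso; apply: X0; exists y.
pose pX : ptopologicalType := HB.pack (Metric.sort X) (isPointed.Build X x0).
have {}cX : @cover_compact pX [set: X] by rewrite -compact_cover.
pose B (x : X) : set X :=
  [set y | forall k, (k < n)%N -> mdist (iter k f x) (iter k f y) < eps].
have Bnbhs x : nbhs x (B x).
  have H k : \forall y \near x, mdist (iter k f x) (iter k f y) < eps.
    have /(_ (ball (iter k f x) eps)) := @continuous_iter f k cf x.
    by move=> /(_ (nbhsx_ballx _ _ e0)); rewrite ballEmdist.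
  rewrite /B; elim: n {B} => [|n IH]; first exact: filterE.
  apply: filterS2 IH (H n) => y yn ynn k; rewrite ltnS leq_eqVlt.
  by move=> /orP[/eqP->//|/yn].
have [i _|x _|D _ DX] := cX X setT (fun x => interior (B x)).
- exact: open_interior.
- by exists x => //; exact: Bnbhs.
exists #|` D|%fset, [set` D]; split; first exact/card_eq_fsetP.
move=> y; have [x xD xy] := DX y I.
by exists x => // k kn; apply/ltW/(interior_subset xy).
Qed.

Lemma spanning_numberP f n eps : compact [set: X] -> continuous f ->
  0 < eps -> spanning_cards f n eps (spanning_number f n eps) /\
    forall j, spanning_cards f n eps j -> (spanning_number f n eps <= j)%N.
Proof.
move=> cX cf e0; rewrite /spanning_number; case: xgetP => [m _ //|noP].
have [j0 Hj0] := spanning_cards_neq0 n cX cf e0.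
have ex : exists j, `[< spanning_cards f n eps j >] by exists j0; exact/asboolP.
case: (ex_minnP ex) => m /asboolP Hm mle; case: (noP m).
by split=> // j /asboolP; exact: mle.
Qed.

Lemma spanning_number_le f n eps1 eps2 : compact [set: X] -> continuous f ->
  0 < eps1 -> eps1 <= eps2 ->
  (spanning_number f n eps2 <= spanning_number f n eps1)%N.
Proof.
move=> cX cf e0 e12; have [[E [cE sE]] _] := spanning_numberP n cX cf e0.
apply: (spanning_numberP n cX cf (lt_le_trans e0 e12)).2.
exists E; split => // y; have [x Ex xy] := sE y.
by exists x => // k /xy /le_trans; exact.
Qed.

Lemma hpol_eps_le f eps1 eps2 : compact [set: X] -> continuous f ->
  0 < eps1 -> eps1 <= eps2 -> (hpol_eps f eps2 <= hpol_eps f eps1)%E.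
Proof.
move=> cX cf e0 e12; apply: le_ereal_inf_tmp => _ [A FA <-].
apply: (@le_trans _ _ (ereal_sup
    ((fun n => (ln (spanning_number f n eps2)%:R / ln n%:R : R)%:E) @` A))).
  by apply: ereal_inf_lbound; exists A.
apply: ge_ereal_sup => _ [n An <-].
apply: (@le_trans _ _ (ln (spanning_number f n eps1)%:R / ln n%:R : R)%:E);
  last by apply: ereal_sup_ubound; exists n.
have ln_ge0_nat (m : nat) : 0 <= ln m%:R :> R.
  case: m => [|m]; first by rewrite ln0.
  by rewrite ln_ge0// ler1n.
rewrite lee_fin ler_wpM2r ?invr_ge0//.
have := spanning_number_le n cX cf e0 e12.
case: (spanning_number f n eps2) => [|m] mle; first by rewrite ln0.
by rewrite ler_ln ?ler_nat// posrE ltr0n// (leq_trans _ mle).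
Qed.

Lemma is_cvg_hpol_eps f : compact [set: X] -> continuous f ->
  cvg (hpol_eps f eps @[eps --> 0^'+]).
Proof.
move=> cX cf; apply: nonincreasing_at_right_is_cvge; near=> x => e1 e2.
by rewrite !in_itv/= => /andP[e10 _] _ e12; exact: hpol_eps_le.
Unshelve. all: by end_near. Qed.

End polynomial_entropy.

(* Main.v *)
Require Import Defs.
From mathcomp Require Import all_boot all_order all_algebra.
From mathcomp Require Import all_classical all_reals all_analysis.
From mathcomp Require Import lra zify.

(** Expansiveness yields, for a suitable M and every j, two points whose orbits
    stay very close at the times sM, s < j, but are far apart at time jM.
    Approximating the two points for j < n by points of an (nM, eps)-spanning
    set S gives n edges on the vertex set S, edge j being long in the metric
    d_j(u, v) = dist(f^(jM) u, f^(jM) v) and short in d_s for s < j.  A walk of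
    at most k edges with increasing labels is then determined by its endpoints,
    as the smallest label where two such walks part would be a long edge bounded
    by short ones.  Deleting k times at each vertex the D edges with the largest
    labels costs at most kD|S| edges, and any edge left is followed by D^k
    increasing walks of length k.  Hence D^k <= |S| as soon as kD|S| < n, that
    is n^k <= (2k)^k |S|^(k+1), so that h_pol >= k/(k+1). *)

Set Implicit Arguments.
Unset Strict Implicit.
Unset Printing Implicit Defensive.

Import Order.TTheory GRing.Theory Num.Theory.
Import numFieldNormedType.Exports.

Local Open Scope ring_scope.

(** * Counting increasing walks in a graph with ordered edges *)

Section increasing_walks.
Context {R : realDomainType} {V : finType} {n : nat}.
Variables (a b : 'I_n -> V) (d : 'I_n -> V -> V -> R) (eta : R) (k : nat).
Hypothesis eta_ge0 : 0 <= eta.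
Hypothesis dxx : forall s v, d s v v = 0.
Hypothesis dC : forall s u v, d s u v = d s v u.
Hypothesis dD : forall s u v w, d s u w <= d s u v + d s v w.
Hypothesis d_later : forall s j : 'I_n, (s < j)%N -> d s (a j) (b j) <= eta.
(** The factor 2k + 1 leaves room for a detour around edge j made of one short edge and two walks of
    at most k short edges each. *)
Hypothesis d_own : forall j, eta *+ k.*2.+1 < d j (a j) (b j).

Definition incident v j := (a j == v) || (b j == v).

Definition opposite v j := if a j == v then b j else a j.

(* Endpoints of the walks of i edges from v whose labels increase from t on,
   t excluded. *)
Fixpoint reach i v (t : 'I_n) : {set V} :=
  if i is i'.+1 then
    \bigcup_(j : 'I_n | (t < j)%N && incident v j) reach i' (opposite v j) j
  else [set v].

Lemma dist_opposite s v j : incident v j ->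
  d s v (opposite v j) = d s (a j) (b j).
Proof.
by rewrite /incident /opposite; case: eqVneq => [->//|_ /eqP <-]; rewrite dC.
Qed.

Lemma incident_opposite v j : incident v j -> incident (opposite v j) j.
Proof.
by rewrite /incident /opposite; case: eqVneq => _ _; rewrite eqxx ?orbT.
Qed.

(** All labels on the walk exceed t, hence s, so each of its i edges has length at most [eta] in
    [d s]. *)
Lemma dist_reach i v (s t : 'I_n) w : (s <= t)%N -> w \in reach i v t ->
  d s v w <= eta *+ i.
Proof.
elim: i v t => [|i IH] v t st /=; first by rewrite inE => /eqP ->; rewrite dxx.
case/bigcupP => j /andP[tj vj] wj; have sj := leq_ltn_trans st tj.
rewrite mulrS (le_trans (dD s v (opposite v j) w))// lerD//.
  by rewrite dist_opposite// d_later.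
exact: IH (ltnW sj) wj.
Qed.

(* Of two increasing walks leaving v through different edges, the earliest edge
   is long at its own time while all the others are short, so that their
   endpoints differ. *)
Lemma reach_disjoint i v j l : (i <= k)%N -> incident v j -> incident v l ->
  (j < l)%N -> [disjoint reach i (opposite v j) j & reach i (opposite v l) l].
Proof.
move=> ik vj vl jl; apply/pred0P => w /=; apply/negP => /andP[wj wl].
have := d_own j; rewrite -(dist_opposite _ vj) ltNge => /negP; apply.
have dl := dist_reach (ltnW jl) wl; have dj := dist_reach (leqnn j) wj.
apply: (le_trans (dD j v (opposite v l) _)).
rewrite mulrS lerD// ?dist_opposite ?d_later//.
apply: (le_trans (dD j _ w _)); rewrite -addnn mulrnDr lerD//.
  by rewrite (le_trans dl)// ler_wpMn2l.
by rewrite dC (le_trans dj)// ler_wpMn2l.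
Qed.

Lemma card_disjoint_bigcup (I : finType) (A : {set I}) (F : I -> {set V}) c :
  {in A &, forall i j, i != j -> [disjoint F i & F j]} ->
  {in A, forall i, c <= #|F i|}%N -> (#|A| * c <= #|\bigcup_(i in A) F i|)%N.
Proof.
move=> disjF leF; rewrite -sum_nat_const.
apply: (@leq_trans (\sum_(i in A) #|F i|)); first exact: leq_sum.
rewrite -sum1_card; under eq_bigr do rewrite -sum1_card.
have in_bigcup i x : i \in A -> x \in F i -> x \in \bigcup_(i in A) F i.
  by move=> iA xi; apply/bigcupP; exists i.
rewrite (exchange_big_dep (mem (\bigcup_(i in A) F i))) /=; last first.
  by move=> i x; exact: in_bigcup.
apply: leq_sum => x /bigcupP[i iA xi]; rewrite (big_pred1 i)// => j.
apply/andP/eqP => [[jA xj]|->//]; apply/eqP; apply: contraTT xj => ji.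
by rewrite (disjointFl (disjF j i jA iA ji)).
Qed.

Variable D : nat.

Definition later (E : {set 'I_n}) v j :=
  [set l in E | (j < l)%N && incident v l].

(** All edges counted meet at v. If j has the smallest label among them, the others lie in
    [later E v j], which has fewer than D elements. *)
Lemma card_few_later (E : {set 'I_n}) v :
  (#|[set j in E | incident v j && (#|later E v j| < D)%N]| <= D)%N.
Proof.
set B := [set j in E | _]; have [->|[j0 Bj0]] := set_0Vmem B.
  by rewrite cards0.
pose j := [arg min_(j < j0 in B) (j : nat)].
have [Bj jmin] : j \in B /\ forall l, l \in B -> (j <= l)%N.
  by rewrite /j; case: arg_minnP.
have /and3P[_ _ jD] : [&& j \in E, incident v j & (#|later E v j| < D)%N].
  by move: Bj; rewrite inE.
rewrite (cardsD1 j) Bj; apply: leq_trans jD; rewrite ltnS.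
apply/subset_leq_card/fintype.subsetP => l; rewrite 2!inE => /andP[lj Bl].
move: (Bl); rewrite !inE => /and3P[-> -> _]; rewrite andbT /=.
by rewrite ltn_neqAle jmin// andbT eq_sym.
Qed.

(** Each round removes at every vertex the at most D edges with fewer than D later edges there. A
    surviving edge has D later edges in the previous E, each continued by walks with at least
    [D ^ i] endpoints, and these sets of endpoints are disjoint by [reach_disjoint]. *)
Lemma large_reach i : (i <= k)%N -> exists2 E : {set 'I_n},
  (n <= #|E| + i * D * #|V|)%N &
  forall j v, j \in E -> incident v j -> (D ^ i <= #|reach i v j|)%N.
Proof.
elim: i => [_|i IH ik].
  exists finset.setT => [|j v _ _]; last by rewrite cards1.
  by rewrite finset.cardsT card_ord leq_addr.
have [E nE DE] := IH (ltnW ik).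
pose bad v := [set j in E | incident v j && (#|later E v j| < D)%N].
exists (E :\: \bigcup_v bad v).
  have : (#|\bigcup_v bad v| <= D * #|V|)%N.
    rewrite mulnC -sum_nat_const.
    elim/big_ind2: _ => [|B p C q Bp Cq|v _]; rewrite ?cards0 ?card_few_later//.
    exact: leq_trans (leq_card_setU _ _).1 (leq_add Bp Cq).
  have := cardsID (\bigcup_v bad v) E.
  have := subset_leq_card (subsetIr E (\bigcup_v bad v)).
  rewrite mulSn mulnDl; lia.
move=> j v; rewrite inE => /andP[/bigcupP jbad jE] vj.
have Dlater : (D <= #|later E v j|)%N.
  rewrite leqNgt; apply/negP => jD; apply: jbad.
  by exists v; rewrite ?inE ?jE ?vj.
have inlater l : l \in later E v j -> [/\ l \in E, (j < l)%N & incident v l].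
  by rewrite inE => /and3P.
rewrite expnS; apply: (@leq_trans #|\bigcup_(l in later E v j)
    reach i (opposite v l) l|).
  apply: leq_trans (card_disjoint_bigcup (c := D ^ i) _ _).
  - by rewrite leq_mul2r Dlater orbT.
  - move=> l m /inlater[_ _ vl] /inlater[_ _ vm] lm.
    have [{}lm|{}lm|/val_inj/eqP] := ltngtP l m; last by rewrite (negPf lm).
      exact: reach_disjoint (ltnW ik) vl vm lm.
    by rewrite disjoint_sym; exact: reach_disjoint (ltnW ik) vm vl lm.
  - by move=> l /inlater[lE _ vl]; apply: DE => //; exact: incident_opposite.
apply/subset_leq_card/bigcupsP => l /inlater[_ jl vl] /=.
by apply: (bigcup_max l); rewrite ?jl.
Qed.

Lemma many_edges_many_vertices : (k * D * #|V| < n)%N -> (D ^ k <= #|V|)%N.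
Proof.
move=> Vn; have [E nE DE] := large_reach (leqnn k).
have [E0|[j jE]] := set_0Vmem E.
  by move: nE; rewrite E0 cards0 add0n leqNgt Vn.
by rewrite (leq_trans (DE j (a j) jE _)) ?max_card// /incident eqxx.
Qed.
End increasing_walks.

Local Open Scope classical_set_scope.

(** * Pairs of orbits that first separate at a prescribed time *)

Section separating_pairs.
Context {R : realType} {X : metricType R}.
Variable f : X -> X.
Hypothesis X_compact : compact [set: X].
Hypothesis f_continuous : continuous f.

(** Indexing the spanning set by ['I_m] provides the finite vertex type of the graph; g sends a
    point to the vertex that approximates it. *)
Lemma spanning_cards_coding n eps m : spanning_cards f n eps m ->
  exists (e : 'I_m -> X) (g : X -> 'I_m), forall y k, (k < n)%N ->
    mdist (iter k f (e (g y))) (iter k f y) <= eps.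
Proof.
move=> [E [/card_set_bijP[h [hE hinj hsurj]] sE]].
have /choice[e eP] (i : 'I_m) : exists x, E x /\ h x = i.
  by have [x Ex hx] := hsurj i (ltn_ord i); exists x.
have /choice[g gP] y : exists i : 'I_m, forall k, (k < n)%N ->
    mdist (iter k f (e i)) (iter k f y) <= eps.
  have [x Ex xy] := sE y; exists (Ordinal (hE x Ex)).
  have [Ee he] := eP (Ordinal (hE x Ex)).
  by rewrite (_ : e _ = x)//; apply: hinj; rewrite ?inE.
by exists e, g.
Qed.

(** By pigeonhole, two distinct points are approximated within c/3 by the same element of a finite
    spanning set. *)
Lemma close_pair n c : infinite_set [set: X] -> 0 < c ->
  exists x y, x <> y /\
    forall k, (k < n)%N -> mdist (iter k f x) (iter k f y) < c.
Proof.
move=> X_infinite c0; have c30 : 0 < c / 3 by rewrite divr_gt0.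
have [m /spanning_cards_coding[e [g gP]]] :=
  spanning_cards_neq0 n X_compact f_continuous c30.
have [x [y [gxy xy]]] : exists x y, g x = g y /\ x <> y.
  apply: contrapT => H; apply: X_infinite.
  apply: (@card_le_finite _ _ _ `I_m); last exact: finite_II.
  apply/pcard_leP/injfunPex; exists (fun x => g x : nat).
    by move=> x _ /=; exact: ltn_ord.
  move=> x y _ _ /val_inj gxy; apply: contrapT => xy.
  by apply: H; exists x, y.
exists x, y; split=> // k kn; have := gP x k kn; have := gP y k kn.
rewrite -gxy => ey; rewrite metric_sym => ex.
apply: le_lt_trans (metric_triangle _ (iter k f (e (g x))) _) _; lra.
Qed.

Lemma near_mdist (g : X -> X) (x y : X) eps : continuous g -> 0 < eps ->
  \forall q \near (x, y),
    `|mdist (g q.1) (g q.2) - mdist (g x) (g y)| < eps.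
Proof.
move=> cg e0; have e20 : 0 < eps / 2 by rewrite divr_gt0.
exists (g @^-1` ball (g x) (eps / 2), g @^-1` ball (g y) (eps / 2)).
  by split; apply: cg; exact: nbhsx_ballx.
move=> [x' y'] /=; rewrite !ballEmdist /= => -[xx' yy'].
have := metric_triangle (g x) (g x') (g y).
have := metric_triangle (g x') (g y') (g y).
have := metric_triangle (g x') (g x) (g y').
have := metric_triangle (g x) (g y) (g y').
rewrite (metric_sym (g x') (g x)) (metric_sym (g y') (g y)) ltr_norml; lra.
Qed.

(** By compactness of the square of X it suffices to argue near each pair. Near the diagonal the
    conclusion holds; near any other pair, a time at which that pair is [delta] apart refutes the
    premise once M exceeds it, because c < [delta]. *)
Lemma uniform_expansiveness c delta eta :
  (forall x y, (forall n, mdist (iter n f x) (iter n f y) < delta) -> x = y) ->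
  c < delta -> 0 < eta -> exists M, forall x y,
    (forall k, (k < M)%N -> mdist (iter k f x) (iter k f y) < c) ->
    mdist x y < eta.
Proof.
move=> expf cdelta eta0.
have /compact_near_coveringP XX := compact_setX X_compact X_compact.
pose P M (q : X * X) :=
  (forall k, (k < M)%N -> mdist (iter k f q.1) (iter k f q.2) < c) ->
  mdist q.1 q.2 < eta.
have /XX[N _ NP] : forall q, ([set: X] `*` [set: X]) q ->
    \forall q' \near q & M \near \oo, P M q'.
  move=> [x y] _; have [xy|/eqP xy] := eqVneq x y.
    have cid : continuous (@id X) by move=> ?; exact: cvg_id.
    exists ([set q | `|mdist (id q.1) (id q.2) - mdist x y| < eta], setT).
      by split; [exact: near_mdist|exact: filterT].
    move=> [[x' y'] M] /= [xy' _] _; move: xy'.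
    by rewrite xy mdistxx subr0 /= ger0_norm// mdist_ge0.
  have [k /negP] : exists k, ~ mdist (iter k f x) (iter k f y) < delta.
    by apply/existsNP => /expf.
  rewrite -leNgt => kxy.
  have dc0 : 0 < delta - c by rewrite subr_gt0.
  exists ([set q | `|mdist (iter k f q.1) (iter k f q.2)
                     - mdist (iter k f x) (iter k f y)| < delta - c],
          [set M | (k < M)%N]).
    split; last by exists k.+1.
    have ck : continuous (iter k f) by exact: continuous_iter.
    exact: (near_mdist x y ck dc0).
  move=> [[x' y'] M] /= [xy' kM] /(_ k kM); rewrite /= => ltc.
  by move: xy'; rewrite ltr_norml => /andP[+ _]; lra.
by exists N => x y; exact: (NP N (leqnn N) (x, y) (conj I I)).
Qed.

(** A pair that stays close before time jM first separates at some N with jM <= N; applying the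
    iterate of order N - jM moves that first separation to time jM. For s < j the orbits are still
    close throughout the M steps from time sM on, so uniform expansiveness applies there. *)
Lemma separating_pairs : infinite_set [set: X] -> positively_expansive f ->
  exists2 c : R, 0 < c & forall eta, 0 < eta -> exists2 M, (0 < M)%N &
    forall j, exists x y, c <= mdist (iter (j * M) f x) (iter (j * M) f y) /\
      forall s, (s < j)%N ->
        mdist (iter (s * M) f x) (iter (s * M) f y) < eta.
Proof.
move=> X_infinite [delta delta0 expf]; exists (delta / 2).
  by rewrite divr_gt0.
move=> eta eta0; have d2 : delta / 2 < delta by lra.
(* The successor only serves to make the time step positive. *)
have [M MP] := uniform_expansiveness expf d2 eta0; exists M.+1 => // j.
have d20 : 0 < delta / 2 by rewrite divr_gt0.
have [x [y [xy closexy]]] := close_pair (j * M.+1) X_infinite d20.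
have [k0 k0P] : exists k, delta / 2 <= mdist (iter k f x) (iter k f y).
  apply: contrapT => H; apply/xy/expf => n; apply: lt_trans d2.
  by rewrite ltNge; apply/negP => nP; apply: H; exists n.
have [N NP Nmin] := ex_minnP (ex_intro (fun k => _ <= _) k0 k0P).
have jN : (j * M.+1 <= N)%N.
  by rewrite leqNgt; apply/negP => /closexy; rewrite ltNge NP.
have iterB s z : iter s f (iter (N - j * M.+1) f z)
  = iter (s + (N - j * M.+1)) f z by rewrite iterD.
exists (iter (N - j * M.+1) f x), (iter (N - j * M.+1) f y).
rewrite !iterB subnKC//; split=> // s sj; rewrite !iterB; apply: MP => k kM.
rewrite -!iterD ltNge; apply/negP => /Nmin.
have : (s.+1 * M.+1 <= j * M.+1)%N by rewrite leq_mul2r sj orbT.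
rewrite mulSn; lia.
Qed.

End separating_pairs.

(** Let p be the largest integer with p^k <= m. The hypothesis fails to give its bound for D = p +
    1, so n <= k(p + 1)m <= 2kpm, as p >= 1; the k-th power of this is bounded using p^k <= m. *)
Lemma leq_exp_of_many_edges k m n : (0 < k)%N -> (0 < m)%N ->
  (forall D, (k * D * m < n)%N -> (D ^ k <= m)%N) ->
  (n ^ k <= k.*2 ^ k * m ^ k.+1)%N.
Proof.
move=> k0 m0 H; have exD : exists D, (m < D ^ k)%N.
  exists m.+1; case: k k0 {H} => // k _.
  by rewrite expnS (leq_trans (ltnSn m))// leq_pmulr// expn_gt0.
case: (ex_minnP exD) => -[|p] pP pmin; first by rewrite exp0n in pP.
have pm : (p ^ k <= m)%N by rewrite leqNgt; apply/negP => /pmin; rewrite ltnn.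
have p0 : (0 < p)%N.
  by case: p pP {pmin pm} => //; rewrite exp1n ltnNge m0.
have np : (n <= k * p.+1 * m)%N.
  by rewrite leqNgt; apply/negP => /H; rewrite leqNgt pP.
have {}np : (n <= k.*2 * p * m)%N.
  by apply: (leq_trans np); rewrite leq_mul2r -doubleMl -mul2n; nia.
apply: (@leq_trans ((k.*2 * p * m) ^ k)); first by rewrite leq_exp2r.
by rewrite !expnMn expnS mulnA leq_mul2r [X in _ || X]leq_mul2l pm !orbT.
Qed.

(** * Growth of spanning numbers and the entropy bound *)

Section spanning_number_growth.
Context {R : realType} {X : metricType R}.
Variable f : X -> X.
Hypothesis X_compact : compact [set: X].
Hypothesis X_infinite : infinite_set [set: X].
Hypothesis f_continuous : continuous f.
Hypothesis f_expansive : positively_expansive f.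

Lemma spanning_number_gt0 n (eps : R) : 0 < eps ->
  (0 < spanning_number f n eps)%N.
Proof.
move=> eps0.
have [/spanning_cards_coding[_ [g _]] _] :=
  spanning_numberP n X_compact f_continuous eps0.
have [x _] := infinite_setN0 X_infinite.
exact: leq_ltn_trans (leq0n _) (ltn_ord (g x)).
Qed.

Lemma spanning_number_growth k : (0 < k)%N ->
  exists (eps : R) (M : nat), [/\ 0 < eps, (0 < M)%N & forall n,
    (n ^ k <= k.*2 ^ k * spanning_number f (n * M) eps ^ k.+1)%N].
Proof.
move=> k0; have [c c0 sepP] :=
  separating_pairs X_compact f_continuous X_infinite f_expansive.
(* After approximation, short edges have length at most 3 [eps] and long ones at least c - 2 [eps],
   so c must exceed 3(2k + 1) [eps] + 2 [eps] = (6k + 5) [eps]. *)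
pose eps : R := c / (6 * k%:R + 6).
have k0R : 0 <= k%:R :> R by [].
have eps0 : 0 < eps by rewrite divr_gt0//; lra.
have cE : c = (6 * k%:R + 6) * eps by rewrite /eps mulrC divfK//; lra.
have [M M0 sepM] := sepP eps eps0.
exists eps, M; split=> // n; set m := spanning_number _ _ _.
have m0 : (0 < m)%N by exact: spanning_number_gt0.
have [/spanning_cards_coding[e [g gP]] _] :=
  spanning_numberP (n * M) X_compact f_continuous eps0.
have /choice[x /choice[y xyP]] := sepM.
pose d (s : 'I_n) (u v : 'I_m) :=
  mdist (iter (s * M) f (e u)) (iter (s * M) f (e v)).
have close (s : 'I_n) z :
    mdist (iter (s * M) f (e (g z))) (iter (s * M) f z) <= eps.
  by apply: gP; rewrite ltn_pmul2r.
apply: leq_exp_of_many_edges => // D; rewrite -[X in (_ * X < _)%N](card_ord m).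
move=> nD; rewrite -[leqRHS](card_ord m).
apply: (@many_edges_many_vertices R 'I_m n (fun j => g (x j))
  (fun j => g (y j)) d (3 * eps) k) nD.
- by rewrite mulr_ge0// ltW.
- by move=> s v; exact: mdistxx.
- by move=> s u v; exact: metric_sym.
- by move=> s u v w; exact: metric_triangle.
- move=> s j sj; have [_ /(_ s sj)] := xyP j.
  have := close s (x j); have := close s (y j).
  rewrite metric_sym /d => ey ex xy.
  apply: le_trans (metric_triangle _ (iter (s * M) f (x j)) _) _.
  have := metric_triangle (iter (s * M) f (x j)) (iter (s * M) f (y j))
    (iter (s * M) f (e (g (y j)))).
  lra.
- move=> j; have [cxy _] := xyP j.
  have := close j (x j); have := close j (y j); rewrite /d.
  rewrite [X in _ -> X <= _ -> _]metric_sym => ey ex.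
  have := metric_triangle (iter (j * M) f (x j)) (iter (j * M) f (e (g (x j))))
    (iter (j * M) f (y j)).
  have := metric_triangle (iter (j * M) f (e (g (x j))))
    (iter (j * M) f (e (g (y j)))) (iter (j * M) f (y j)).
  have -> : 3 * eps *+ k.*2.+1 = 3 * eps * (2 * k%:R + 1).
    by rewrite -mulr_natr -[k.*2.+1%:R]natr1 -mul2n natrM.
  lra.
Qed.

Lemma hpol_eps_le_hpol (eps : R) : 0 < eps -> (hpol_eps f eps <= hpol f)%E.
Proof.
move=> eps0; apply: lime_ge; first exact: is_cvg_hpol_eps.
near=> eps1; apply: hpol_eps_le => //; near: eps1.
exact: nbhs_right_le.
Unshelve. all: by end_near. Qed.

(** The growth bound would give k/(k + 1) in the limit. Settling for (k - 1)/(k + 1) lets the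
    constants 2k and M be absorbed at a single large n, so no limit has to be computed. *)
Lemma hpol_ge k : (0 < k)%N -> ((1 - 2 / k.+1%:R)%:E <= hpol f)%E.
Proof.
move=> k0; have [eps [M [eps0 M0 growth]]] := spanning_number_growth k0.
apply: le_trans (hpol_eps_le_hpol eps0).
apply: le_ereal_inf_tmp => _ [A [N _ NA] <-].
(* The summand N puts nM in the tail contained in A; the other one makes ln n at least k(ln 2k + ln
   M), and its successor ensures n > 1. *)
pose n := (N + ((k.*2 * M) ^ k).+1)%N.
have kM0 : (0 < k.*2 * M)%N by rewrite muln_gt0 double_gt0 k0.
have nM : (N <= n * M)%N by rewrite (leq_trans _ (leq_pmulr n M0))// leq_addr.
apply: le_trans (ereal_sup_ubound _); last by exists (n * M)%N => //; exact: NA.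
rewrite lee_fin; set m := spanning_number _ _ _.
have m0 : (0 < m)%N by exact: spanning_number_gt0.
have n1 : (1 < n)%N by rewrite /n addnS ltnS addn_gt0 expn_gt0 kM0 orbT.
have ln_n_gt0 : 0 < ln n%:R :> R by rewrite ln_gt0// ltr1n.
have ln_M_ge0 : 0 <= ln M%:R :> R by rewrite ln_ge0// ler1n.
have ln_nM : ln (n * M)%:R = ln n%:R + ln M%:R :> R.
  by rewrite natrM lnM// posrE ltr0n// ltnW.
have growth_ln : ln n%:R *+ k <= ln k.*2%:R *+ k + ln m%:R *+ k.+1 :> R.
  rewrite -!lnXn ?ltr0n ?double_gt0 ?(ltnW n1)//.
  rewrite -lnM ?posrE ?exprn_gt0 ?ltr0n ?double_gt0//.
  rewrite -!natrX -natrM ler_ln ?posrE ?ltr0n ?muln_gt0 ?expn_gt0 ?double_gt0;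
    by rewrite ?ler_nat ?growth ?m0 ?k0 ?(ltnW n1).
have n_large : (ln k.*2%:R + ln M%:R) *+ k <= ln n%:R :> R.
  rewrite -lnM ?posrE ?ltr0n ?double_gt0// -natrM -lnXn ?ltr0n// -natrX.
  rewrite ler_ln ?posrE ?ltr0n ?expn_gt0 ?kM0 ?(ltnW n1)//.
  by rewrite ler_nat /n addnS (leq_trans (leqnSn _))// ltnS leq_addl.
rewrite ln_nM ler_pdivlMr ?ltr_wpDr//.
have k1_gt0 : 0 < k.+1%:R :> R by rewrite ltr0n.
rewrite -(ler_pM2l k1_gt0) mulrA mulrBr mulr1 mulrCA divff ?gt_eqF// mulr1.
move: growth_ln n_large.
rewrite -![ln _ *+ _]mulr_natl -[(_ + _) *+ _]mulr_natl -[k.+1%:R]natr1; lra.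
Qed.

End spanning_number_growth.

Theorem theorem4p4 (R : realType) (X : metricType R) (f : X -> X)
  (X_compact : compact [set: X])
  (X_infinite : infinite_set [set: X])
  (f_continuous : continuous f)
  (f_expansive : positively_expansive f) :
  (1 <= hpol f)%E.
Proof.
(* This k exceeds 2/e, so that 2/(k + 1) <= e. *)
apply/lee_subgt0Pr => e e0; pose k := (Num.truncn (2 / e)).+1.
apply: le_trans (hpol_ge X_compact X_infinite f_continuous f_expansive
  (ltn0Sn _ : 0 < k)%N).
rewrite -EFinB lee_fin lerD2l lerN2 ler_pdivrMr// mulrC -ler_pdivrMr//.
by rewrite (le_trans (ltW (truncnS_gt _)))// ler_nat.
Qed.
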